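(* Let $\mathbb{K}=\mathbb{R}$ or $\mathbb{C}$. The joint spectral radius $\rho$ is locally $\frac16$-Hölder continuous on $\mathcal{H}_{>0}(2)=\{\mathcal{M}\in\mathcal{H}(2) : \rho(\mathcal{M})>0\}$, i.e. for every compact $\mathcal{K}\subseteq\mathcal{H}_{>0}(2)$, $$\sup_{\mathcal{M},\mathcal{N}\in\mathcal{K},\ \mathcal{M}\neq\mathcal{N}}\frac{|\rho(\mathcal{M})-\rho(\mathcal{N})|}{d_H(\mathcal{M},\mathcal{N})^{1/6}}<\infty .$$
   Context: $\mathcal{H}(2)$ is the set of nonempty compact subsets of $\mathbb{K}^{2\times2}$ with the Hausdorff metric $d_H(\mathcal{M},\mathcal{N})=\max\{\max_{A\in\mathcal{M}}\min_{B\in\mathcal{N}}\|A-B\|_2,\ \max_{B\in\mathcal{N}}\min_{A\in\mathcal{M}}\|A-B\|_2\}$, where $\|\cdot\|_2$ is the spectral norm; $\mathcal{H}_{>0}(2)$ carries the subspace metric. The joint spectral radius is $\rho(\mathcal{M})=\lim_{k\to\infty}\sup\{\|S\| : S\in\mathcal{S}_k(\mathcal{M})\}^{1/k}$ with $\mathcal{S}_k(\mathcal{M})=\{A_{k-1}\cdots A_0 : A_j\in\mathcal{M}\}$ and any operator norm. *)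

(* Defs.v *)
From HB Require Import structures.
From mathcomp Require Import all_boot all_order all_algebra.
From mathcomp Require Import all_classical all_reals all_analysis.
From mathcomp Require Import complex.
From mathcomp Require Import ring.

Set Implicit Arguments.
Unset Strict Implicit.
Unset Printing Implicit Defensive.

Import Order.TTheory GRing.Theory Num.Theory.
Import numFieldNormedType.Exports.

Local Open Scope classical_set_scope.
Local Open Scope ring_scope.

Variant scalar_kind := RealScalars | ComplexScalars.

Definition scalars (R : realType) (s : scalar_kind) : numFieldType :=
  match s with
  | RealScalars => R
  | ComplexScalars => complex R
  end.

(* The library norm on [complex R] takes its values in [complex R]; [modulus]
   is the [R]-valued absolute value. *)
Definition modulus (R : realType) (s : scalar_kind) : scalars R s -> R :=
  match s with
  | RealScalars => fun x : R => `|x|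
  | ComplexScalars => fun z : complex R => Normc.normc z
  end.

Section normc_topology.
Context {R : rcfType}.

Lemma normc_small (e : complex R) : 0 < e ->
  exists2 r : R, 0 < r & forall x : complex R, Normc.normc x < r -> `|x| < e.
Proof.
case: e => a b; rewrite ltcE /= => /andP[/eqP -> a0]; exists a => // x xa.
by rewrite ltcE /= eqxx.
Qed.

Lemma normc_large (r : R) : 0 < r ->
  exists2 e : complex R, 0 < e & forall x : complex R, `|x| < e -> Normc.normc x < r.
Proof.
move=> r0; exists (real_complex R r); first by rewrite ltcR.
by move=> x; rewrite ltcE /= => /andP[].
Qed.

End normc_topology.

Section modulus_theory.
Context {R : realType}.
Variable s : scalar_kind.
Local Notation K := (scalars R s).
Local Notation modulus := (@modulus R s).
Implicit Types u v : K.

Lemma modulus_ge0 u : 0 <= modulus u.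
Proof. by case: s u => u; [exact: normr_ge0 | case: u => a b; exact: sqrtr_ge0]. Qed.

Lemma modulusD u v : modulus (u + v) <= modulus u + modulus v.
Proof. by case: s u v => u v; [exact: ler_normD | exact: le_normcD]. Qed.

Lemma modulusM u v : modulus (u * v) = modulus u * modulus v.
Proof. by case: s u v => u v; [exact: normrM | exact: Normc.normcM]. Qed.

Lemma modulusN u : modulus (- u) = modulus u.
Proof. by case: s u => u; [exact: normrN | exact: normcN]. Qed.

Lemma modulus0 : modulus 0 = 0.
Proof. by case: s; [exact: normr0 | exact: Normc.normc0]. Qed.

Lemma modulus1 : modulus 1 = 1.
Proof. by case: s; [exact: normr1 | exact: Normc.normc1]. Qed.

Lemma modulus_eq0 u : modulus u = 0 -> u = 0.
Proof. by case: s u => u; [exact: normr0_eq0 | exact: Normc.eq0_normc]. Qed.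

Lemma modulus_small (e : K) : 0 < e ->
  exists2 r : R, 0 < r & forall u, modulus u < r -> `|u| < e.
Proof. by case: s e => e e0; [exists e | exact: normc_small]. Qed.

Lemma modulus_large (r : R) : 0 < r ->
  exists2 e : K, 0 < e & forall u, `|u| < e -> modulus u < r.
Proof. by case: s => r0; [exists r | exact: normc_large]. Qed.

End modulus_theory.

Section spectral_norm.
Context {R : realType} {s : scalar_kind} {d : nat}.
Local Notation K := (scalars R s).
Local Notation modulus := (@modulus R s).

Implicit Types (A B C : 'M[K]_d) (u v : 'cV[K]_d).

Definition euclidean_norm (v : 'cV[K]_d) : R :=
  Num.sqrt (\sum_(i < d) modulus (v i 0) ^+ 2).

Definition spectral_norm (A : 'M[K]_d) : R :=
  sup [set euclidean_norm (A *m v) | v in [set v | euclidean_norm v <= 1]].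

Local Notation enorm := euclidean_norm.
Local Notation snorm := spectral_norm.

Let sumsq_ge0 (a : 'I_d -> R) : 0 <= \sum_i a i ^+ 2.
Proof. by apply: sumr_ge0 => i _; exact: sqr_ge0. Qed.

Let cauchy (a b : 'I_d -> R) :
  \sum_i a i * b i <= Num.sqrt (\sum_i a i ^+ 2) * Num.sqrt (\sum_i b i ^+ 2).
Proof.
set A := Num.sqrt _; set B := Num.sqrt _.
have Z (f : 'I_d -> R) : Num.sqrt (\sum_i f i ^+ 2) = 0 -> forall i, f i = 0.
  move/eqP; rewrite sqrtr_eq0 => h i; apply/eqP; rewrite -sqrf_eq0.
  have /eqP h0 : \sum_i f i ^+ 2 == 0 by rewrite eq_le h sumsq_ge0.
  by have /psumr_eq0P -> : forall i, true -> 0 <= f i ^+ 2 by move=> *; exact: sqr_ge0.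
have [/Z A0|A0] := eqVneq A 0.
  by rewrite big1 ?mulr_ge0 ?sqrtr_ge0// => i _; rewrite A0 mul0r.
have [/Z B0|B0] := eqVneq B 0.
  by rewrite big1 ?mulr_ge0 ?sqrtr_ge0// => i _; rewrite B0 mulr0.
have A_gt0 : 0 < A by rewrite lt_neqAle eq_sym A0 sqrtr_ge0.
have B_gt0 : 0 < B by rewrite lt_neqAle eq_sym B0 sqrtr_ge0.
have h : 0 <= \sum_i (B * a i - A * b i) ^+ 2 by exact: sumsq_ge0.
have E : \sum_i (B * a i - A * b i) ^+ 2 =
    2 * (A * B) * (A * B - \sum_i a i * b i).
  have -> : \sum_i (B * a i - A * b i) ^+ 2 =
     B ^+ 2 * (\sum_i a i ^+ 2) + A ^+ 2 * (\sum_i b i ^+ 2)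
      - 2 * (A * B) * \sum_i a i * b i.
    rewrite !mulr_sumr -big_split -sumrB /=; apply: eq_bigr => i _; ring.
  rewrite -[X in B ^+ 2 * X](sqr_sqrtr (sumsq_ge0 a)).
  rewrite -[X in A ^+ 2 * X](sqr_sqrtr (sumsq_ge0 b)) -/A -/B; ring.
by move: h; rewrite E pmulr_rge0 ?subr_ge0// !mulr_gt0.
Qed.

Lemma euclidean_norm_ge0 v : 0 <= enorm v.
Proof. exact: sqrtr_ge0. Qed.

Lemma euclidean_normD u v : enorm (u + v) <= enorm u + enorm v.
Proof.
rewrite -(@ler_pXn2r _ 2) ?nnegrE ?addr_ge0 ?sqrtr_ge0//.
rewrite sqrrD !sqr_sqrtr ?sumsq_ge0//.
apply: (@le_trans _ _ (\sum_i (modulus (u i 0) + modulus (v i 0)) ^+ 2)).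
  apply: ler_sum => i _; rewrite !mxE ler_pXn2r ?nnegrE ?modulus_ge0 ?modulusD//.
  by rewrite addr_ge0 ?modulus_ge0.
under eq_bigr do rewrite sqrrD.
rewrite !big_split /= lerD2r lerD2l mulr2n; apply: lerD;
  exact: cauchy.
Qed.

Lemma euclidean_normN v : enorm (- v) = enorm v.
Proof. by congr Num.sqrt; apply: eq_bigr => i _; rewrite mxE modulusN. Qed.

Lemma modulus_le_euclidean_norm v i : modulus (v i 0) <= enorm v.
Proof.
rewrite -(@ger0_norm _ (modulus (v i 0))) ?modulus_ge0// -sqrtr_sqr.
apply: ler_wsqrtr; rewrite (bigD1 i) //= lerDl.
by apply: sumr_ge0 => j _; exact: sqr_ge0.
Qed.

Lemma euclidean_norm_le_sum v : enorm v <= \sum_i modulus (v i 0).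
Proof.
have S0 : 0 <= \sum_i modulus (v i 0) by apply: sumr_ge0 => i _; exact: modulus_ge0.
rewrite -[leRHS]ger0_norm// -sqrtr_sqr; apply: ler_wsqrtr.
rewrite expr2 mulr_suml; apply: ler_sum => i _.
rewrite expr2 ler_wpM2l ?modulus_ge0//.
by rewrite (bigD1 i) //= lerDl; apply: sumr_ge0 => j _; exact: modulus_ge0.
Qed.

Let entry_sum (A : 'M[K]_d) : R := \sum_i \sum_j modulus (A i j).

Let enorm_mul_le (A : 'M[K]_d) v : enorm v <= 1 -> enorm (A *m v) <= entry_sum A.
Proof.
move=> v1; apply: le_trans (euclidean_norm_le_sum _) _.
apply: ler_sum => i _; rewrite mxE.
have: forall r : seq 'I_d, modulus (\sum_(j <- r) A i j * v j 0)
    <= \sum_(j <- r) modulus (A i j).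
  elim=> [|j r IH]; first by rewrite !big_nil modulus0.
  rewrite !big_cons; apply: le_trans (modulusD _ _) _; apply: lerD => //.
  rewrite modulusM ler_piMr ?modulus_ge0//.
  exact: le_trans (modulus_le_euclidean_norm _ _) v1.
exact.
Qed.

Let enorm0 : enorm 0 = 0.
Proof.
by rewrite /enorm big1 ?sqrtr0// => i _; rewrite mxE modulus0 expr0n.
Qed.

Lemma has_sup_spectral_norm (A : 'M[K]_d) :
  has_sup [set enorm (A *m v) | v in [set v | enorm v <= 1]].
Proof.
split; first by exists (enorm (A *m 0)), 0; rewrite //= enorm0.
by exists (entry_sum A) => _ [v v1 <-]; exact: enorm_mul_le.
Qed.

Let le_snorm (A : 'M[K]_d) v : enorm v <= 1 -> enorm (A *m v) <= snorm A.
Proof. by move=> v1; apply: ub_le_sup; [case: (has_sup_spectral_norm A) | exists v]. Qed.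

Let snorm_le (A : 'M[K]_d) c :
  (forall v, enorm v <= 1 -> enorm (A *m v) <= c) -> snorm A <= c.
Proof.
by move=> h; apply: ge_sup; [case: (has_sup_spectral_norm A) | move=> _ [v /h ? <-]].
Qed.

Lemma spectral_norm_ge0 A : 0 <= snorm A.
Proof. by rewrite -enorm0 -(mulmx0 _ A); apply: le_snorm; rewrite enorm0. Qed.

Lemma spectral_normD A B : snorm (A + B) <= snorm A + snorm B.
Proof.
apply: snorm_le => v v1; rewrite mulmxDl; apply: le_trans (euclidean_normD _ _) _.
by apply: lerD; exact: le_snorm.
Qed.

Lemma spectral_normN A : snorm (- A) = snorm A.
Proof.
have h B : snorm (- B) <= snorm B.
  by apply: snorm_le => v v1; rewrite mulNmx euclidean_normN; exact: le_snorm.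
by apply/eqP; rewrite eq_le h -{1}(opprK A) h.
Qed.

Lemma spectral_normBC A B : snorm (A - B) = snorm (B - A).
Proof. by rewrite -opprB spectral_normN. Qed.

Lemma spectral_norm_triangle B A C : snorm (A - C) <= snorm (A - B) + snorm (B - C).
Proof.
by apply: le_trans (spectral_normD _ _); rewrite addrA subrK.
Qed.

Lemma spectral_norm0 : snorm 0 = 0.
Proof.
apply/eqP; rewrite eq_le spectral_norm_ge0 andbT.
by apply: snorm_le => v _; rewrite mul0mx enorm0.
Qed.

Lemma modulus_le_spectral_norm (A : 'M[K]_d) i j : modulus (A i j) <= snorm A.
Proof.
pose v : 'cV[K]_d := delta_mx j 0.
have <- : (A *m v) i 0 = A i j by rewrite -colE mxE.
apply: le_trans (modulus_le_euclidean_norm _ _) _; apply: le_snorm.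
rewrite /enorm (bigD1 j) //= big1 => [|k kj].
  by rewrite addr0 mxE !eqxx modulus1 expr1n sqrtr1.
by rewrite mxE (negbTE kj) modulus0 expr0n.
Qed.

Lemma spectral_norm_le_sum (A : 'M[K]_d) :
  snorm A <= \sum_i \sum_j modulus (A i j).
Proof. by apply: snorm_le => v; exact: enorm_mul_le. Qed.

(* The spectral norm induces the library topology on matrices. *)
Lemma nbhs_spectral_norm (A : 'M[K]_d) (U : set 'M[K]_d) :
  nbhs A U <-> exists2 e : R, 0 < e & [set B | snorm (A - B) < e] `<=` U.
Proof.
split.
- move=> /nbhs_ballP[e /= e0 eU]; have [r r0 re] := modulus_small e0.
  exists r => // B /= AB; apply: eU; split => // i j.
  rewrite /ball /= ; apply: re.
  by apply: le_lt_trans AB; have := modulus_le_spectral_norm (A - B) i j; rewrite !mxE.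
- move=> [e e0 eU].
  have [e' e'0 h] := @modulus_large R s (e / (d * d).+1%:R) (divr_gt0 e0 (ltr0Sn _ _)).
  apply/nbhs_ballP; exists e' => // B [_ AB]; apply: eU => /=.
  apply: le_lt_trans (spectral_norm_le_sum _) _.
  apply: (@le_lt_trans _ _ (\sum_(i < d) \sum_(j < d) (e / (d * d).+1%:R))).
    by apply: ler_sum => i _; apply: ler_sum => j _; rewrite !mxE ltW// h//; exact: AB.
  rewrite !sumr_const !card_ord -mulrnA -[_ *+ (d * d)]mulr_natr mulrAC ltr_pdivrMr ?ltr0Sn//.
  by rewrite ltr_pM2l// ltr_nat ltnS.
Qed.

Lemma continuous_spectral_norm : continuous (snorm : 'M[K]_d -> R).
Proof.
move=> A; apply/(@cvgrPdist_lt R R^o _ _ (nbhs_filter A)) => e e0.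
apply/nbhs_spectral_norm; exists e => // B AB.
apply: le_lt_trans AB; rewrite /= ler_norml lerBDr lerBlDr; apply/andP; split.
  rewrite addrC lerBlDr [leRHS]addrC spectral_normBC.
  by apply: le_trans (spectral_normD _ _); rewrite subrK.
by apply: le_trans (spectral_normD _ _); rewrite subrK.
Qed.

Lemma compact_spectral_bounded (M : set 'M[K]_d) : compact M ->
  exists c, forall A, M A -> snorm A <= c.
Proof.
move=> Mc.
have := continuous_compact (continuous_subspaceT continuous_spectral_norm) Mc.
move=> /compact_bounded[c [_ h]]; exists (c + 1) => A MA.
apply: le_trans (ler_norm _) _; apply: (h (c + 1)); first by rewrite ltrDl.
by exists A.
Qed.

End spectral_norm.

Section hausdorff_distance.
Context {R : realType} {s : scalar_kind} {d : nat}.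
Local Notation K := (scalars R s).

Definition hausdorff_dist (M N : set 'M[K]_d) : R :=
  Num.max
    (sup [set inf [set spectral_norm (A - B) | B in N] | A in M])
    (sup [set inf [set spectral_norm (A - B) | A in M] | B in N]).

End hausdorff_distance.

(* The space H(d) of nonempty compact sets of d x d matrices. *)
Record compacts (R : realType) (s : scalar_kind) (d : nat) := Compacts {
  compacts_set :> set 'M[scalars R s]_d;
  compacts_nonempty : compacts_set !=set0;
  compacts_compact : compact compacts_set }.

HB.instance Definition _ R s d := gen_eqMixin (compacts R s d).
HB.instance Definition _ R s d := gen_choiceMixin (compacts R s d).

Section compacts_metric.
Context {R : realType} {s : scalar_kind} {d : nat}.
Local Notation K := (scalars R s).
Local Notation snorm := (@spectral_norm R s d).
Implicit Types (M N P : compacts R s d) (A B C : 'M[K]_d).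

Lemma compacts_eq M N : M = N :> set _ -> M = N.
Proof.
case: M N => [M M0 Mc] [N N0 Nc] /= MN; subst N.
by congr Compacts; exact: Prop_irrelevance.
Qed.

Let point_dist A N := inf [set snorm (A - B) | B in (N : set _)].
Let excess M N := sup [set point_dist A N | A in (M : set _)].

Let hausdorff_distE M N : hausdorff_dist M N = Num.max (excess M N) (excess N M).
Proof.
rewrite /hausdorff_dist; congr (Num.max _ (sup _)); apply: eq_imagel => B _.
by congr inf; apply: eq_imagel => A _; exact: spectral_normBC.
Qed.

Let point_dist_has_inf A N : has_inf [set snorm (A - B) | B in (N : set _)].
Proof.
split; first by have [B NB] := compacts_nonempty N; exists (snorm (A - B)), B.
by exists 0 => _ [B _ <-]; exact: spectral_norm_ge0.
Qed.

Let point_dist_le A B N : compacts_set N B -> point_dist A N <= snorm (A - B).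
Proof. by move=> NB; apply: ge_inf; [case: (point_dist_has_inf A N) | exists B]. Qed.

Let le_point_dist A N c :
  (forall B, compacts_set N B -> c <= snorm (A - B)) -> c <= point_dist A N.
Proof.
by move=> h; apply: lb_le_inf; [case: (point_dist_has_inf A N) | move=> _ [B /h ? <-]].
Qed.

Let excess_has_sup M N : has_sup [set point_dist A N | A in (M : set _)].
Proof.
split; first by have [A MA] := compacts_nonempty M; exists (point_dist A N), A.
have [c cM] := compact_spectral_bounded (@compacts_compact _ _ _ M).
have [B NB] := compacts_nonempty N.
exists (c + snorm B) => _ [A MA <-]; apply: le_trans (point_dist_le A NB) _.
by apply: le_trans (spectral_normD _ _) _; rewrite spectral_normN lerD2r cM.
Qed.

Let le_excess A M N : compacts_set M A -> point_dist A N <= excess M N.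
Proof. by move=> MA; apply: ub_le_sup; [case: (excess_has_sup M N) | exists A]. Qed.

Let excess_le M N c : (forall A, compacts_set M A -> point_dist A N <= c) -> excess M N <= c.
Proof.
by move=> h; apply: ge_sup; [case: (excess_has_sup M N) | move=> _ [A /h ? <-]].
Qed.

Let excess_triangle N M P : excess M P <= excess M N + excess N P.
Proof.
apply: excess_le => A MA; rewrite -lerBlDr.
apply: (@le_trans _ _ (point_dist A N)); last exact: le_excess.
apply: le_point_dist => B NB; rewrite lerBlDr -lerBlDl.
apply: (@le_trans _ _ (point_dist B P)); last exact: le_excess.
apply: le_point_dist => C PC; rewrite lerBlDl.
by apply: le_trans (point_dist_le _ PC) (spectral_norm_triangle B A C).
Qed.

Let excess_eq0 M N : excess M N <= 0 -> compacts_set M `<=` N.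
Proof.
move=> MN A MA.
have Ncl : closed (N : set 'M[K]_d).
  by apply: compact_closed (@compacts_compact _ _ _ N); exact: norm_hausdorff.
apply: Ncl => U /nbhs_spectral_norm[e e0 eU].
have : point_dist A N < e by apply: le_lt_trans (le_excess _ MA) (le_lt_trans MN e0).
move=> /(inf_lt (point_dist_has_inf A N).1) [_ [B NB <-] ABe].
by exists B; split => //; exact: eU.
Qed.

Lemma hausdorff_distxx M : hausdorff_dist M M = 0.
Proof.
rewrite hausdorff_distE maxxx; apply/eqP; rewrite eq_le; apply/andP; split.
  apply: excess_le => A MA; apply: le_trans (point_dist_le A MA) _.
  by rewrite subrr spectral_norm0.
have [A MA] := compacts_nonempty M; apply: le_trans (le_excess M MA).
by apply: le_point_dist => B _; exact: spectral_norm_ge0.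
Qed.

Lemma hausdorff_dist_eq0 M N : hausdorff_dist M N = 0 -> M = N.
Proof.
rewrite hausdorff_distE => h; apply: compacts_eq; apply/seteqP.
by split; apply: excess_eq0; rewrite -h le_max lexx ?orbT.
Qed.

Lemma hausdorff_distC M N : hausdorff_dist M N = hausdorff_dist N M.
Proof. by rewrite !hausdorff_distE maxC. Qed.

Lemma hausdorff_dist_triangle N M P :
  hausdorff_dist M P <= hausdorff_dist M N + hausdorff_dist N P.
Proof.
rewrite !hausdorff_distE ge_max; apply/andP; split.
  by apply: le_trans (excess_triangle N M P) (lerD _ _); rewrite le_max lexx.
rewrite addrC.
by apply: le_trans (excess_triangle N P M) (lerD _ _); rewrite le_max lexx orbT.
Qed.

End compacts_metric.

HB.instance Definition _ (R : realType) (s : scalar_kind) (d : nat) :=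
  isMetric.Build R (compacts R s d)
    (@hausdorff_distxx R s d) (@hausdorff_dist_eq0 R s d)
    (@hausdorff_distC R s d) (@hausdorff_dist_triangle R s d).

Lemma mdist_compactsE (R : realType) (s : scalar_kind) (d : nat)
  (M N : compacts R s d) : mdist M N = hausdorff_dist M N.
Proof. by []. Qed.

Section joint_spectral_radius.
Context {R : realType} {s : scalar_kind} {d : nat}.
Local Notation K := (scalars R s).

(* [rev_ord] makes the k-th product A_(k-1) *m ... *m A_0. *)
Definition products (k : nat) (M : set 'M[K]_d) : set 'M[K]_d :=
  [set \big[mulmx/1%:M]_(j < k) A (rev_ord j) |
     A in [set A : 'I_k -> 'M[K]_d | forall j, M (A j)]].

(* The value does not depend on the operator norm; the spectral norm is used. *)
Definition joint_spectral_radius (M : set 'M[K]_d) : R :=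
  limn (fun k => sup [set spectral_norm S | S in products k M] `^ (k%:R^-1)).

End joint_spectral_radius.

Definition positive_jsr {R : realType} {s : scalar_kind} {d : nat} :
    set (compacts R s d) :=
  [set M | 0 < joint_spectral_radius M].

(* Main.v *)
Require Import Defs.
From mathcomp Require Import all_boot all_order all_algebra.
From mathcomp Require Import all_classical all_reals all_analysis.
From mathcomp Require Import complex.
From mathcomp Require Import ring lra zify.

Set Implicit Arguments.
Unset Strict Implicit.
Unset Printing Implicit Defensive.

Import Order.TTheory GRing.Theory Num.Theory.
Import numFieldNormedType.Exports.

Local Open Scope classical_set_scope.
Local Open Scope ring_scope.

(** Write |S| for the sum of the moduli of the entries of S, a norm equivalent
    to the spectral norm but easier to compute with, and S_k for the set of
    products of length k of matrices in M.

    The joint spectral radius rho is the infimum of the growth rates of M, the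
    numbers r > 0 such that |S| <= C r^k for some C and all k and S in S_k
    ([joint_spectral_radiusE]). A bound on C in terms of r is a quantitative
    form of upper semicontinuity: if every matrix of N lies within eta of M,
    then t + C eta is a growth rate of N as soon as |S| <= C t^k on all S_k
    ([growth_bound_perturbation]). Exchanging M and N gives the other
    inequality, so it suffices to bound C uniformly over bounded sets M.

    The bound comes from a form of Bochi's inequality for 2 x 2 matrices
    ([entry_norm_products_mul]): for every growth rate r,
      |S S'| <= 8 (r^l |S| + r^k |S'|)    for S in S_k and S' in S_l.
    Its constant does not depend on C. The reason is that in a suitable basis
    all of S_k has entries at most about r^k; this basis may be arbitrarily
    ill-conditioned, but the part of a matrix that the bad conditioning
    inflates is a multiple of one fixed nilpotent matrix Z
    ([split_along_exists]). Since Z^2 = 0, a product of two matrices cannot be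
    inflated twice.

    By this inequality, doubling k multiplies the largest |S| / r^k by at most
    16 = 2^4, so that |S| <= 16 k^4 (c / r) r^k when c bounds M
    ([entry_norm_products_dyadic]). For r = rho + h, the factor k^4 is
    absorbed by raising the rate to t = r (1 + h)^4, at the price of h^-4, and
    1 / r <= 1 / h. This gives C = 16 c h^-5
    ([growth_bound_polynomial]), while t exceeds rho by a multiple of h.
    Hence rho(N) <= rho(M) + O(h) + O(eta h^-5), and h = d_H(M, N)^(1/6)
    balances the two errors ([joint_spectral_radius_hoelder]). *)

(** * The entrywise norm and products of matrices *)

Section entry_norm.
Context {R : realType} {s : scalar_kind}.
Local Notation K := (scalars R s).

Definition entry_norm m n (A : 'M[K]_(m, n)) : R :=
  \sum_i \sum_j modulus (A i j).

Lemma entry_norm_ge0 m n (A : 'M[K]_(m, n)) : 0 <= entry_norm A.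
Proof. by apply: sumr_ge0 => i _; apply: sumr_ge0 => j _; exact: modulus_ge0. Qed.

Lemma modulus_le_entry_norm m n (A : 'M[K]_(m, n)) i j :
  modulus (A i j) <= entry_norm A.
Proof.
rewrite /entry_norm (bigD1 i) //= (bigD1 j) //= -addrA lerDl.
by rewrite addr_ge0 ?sumr_ge0// => k _; rewrite ?sumr_ge0// => *; exact: modulus_ge0.
Qed.

Lemma modulus_sum (I : finType) (F : I -> K) :
  modulus (\sum_i F i) <= \sum_i modulus (F i).
Proof.
elim/big_ind2: _ => [|x x' y y' hx hy|i _]; rewrite ?modulus0//.
exact: le_trans (modulusD _ _) (lerD hx hy).
Qed.

Lemma entry_normD m n (A B : 'M[K]_(m, n)) :
  entry_norm (A + B) <= entry_norm A + entry_norm B.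
Proof.
rewrite /entry_norm -big_split; apply: ler_sum => i _; rewrite -big_split /=.
by apply: ler_sum => j _; rewrite mxE modulusD.
Qed.

Lemma entry_normZ m n a (A : 'M[K]_(m, n)) :
  entry_norm (a *: A) = modulus a * entry_norm A.
Proof.
rewrite /entry_norm mulr_sumr; apply: eq_bigr => i _; rewrite mulr_sumr.
by apply: eq_bigr => j _; rewrite mxE modulusM.
Qed.

Lemma entry_normM m n p (A : 'M[K]_(m, n)) (B : 'M[K]_(n, p)) :
  entry_norm (A *m B) <= entry_norm A * entry_norm B.
Proof.
rewrite /entry_norm mulr_suml; apply: ler_sum => i _.
have -> : (\sum_j modulus (A i j)) * (\sum_k \sum_l modulus (B k l)) =
    \sum_j modulus (A i j) * (\sum_k \sum_l modulus (B k l)) by rewrite mulr_suml.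
apply: (@le_trans _ _ (\sum_l \sum_j modulus (A i j) * modulus (B j l))).
  apply: ler_sum => l _; rewrite mxE; apply: le_trans (modulus_sum _) _.
  by apply: ler_sum => j _; rewrite modulusM.
rewrite exchange_big /=; apply: ler_sum => j _; rewrite -mulr_sumr.
rewrite ler_wpM2l ?modulus_ge0// [leRHS](bigD1 j) //= lerDl.
by rewrite sumr_ge0// => k _; rewrite sumr_ge0// => l _; exact: modulus_ge0.
Qed.

Lemma spectral_norm_le_entry_norm d (A : 'M[K]_d) :
  spectral_norm A <= entry_norm A.
Proof. exact: spectral_norm_le_sum. Qed.

Lemma entry_norm_le_spectral_norm d (A : 'M[K]_d) :
  entry_norm A <= (d * d)%:R * spectral_norm A.
Proof.
apply: (@le_trans _ _ (\sum_(i < d) \sum_(j < d) spectral_norm A)).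
  by apply: ler_sum => i _; apply: ler_sum => j _; exact: modulus_le_spectral_norm.
by rewrite !sumr_const !card_ord -mulrnA mulr_natl.
Qed.

End entry_norm.

Section products.
Context {R : realType} {s : scalar_kind} {d : nat}.
Local Notation K := (scalars R s).
Implicit Types (M N : set 'M[K]_d) (A B S : 'M[K]_d) (k l : nat).

Lemma products0 M : products 0 M = [set 1%:M].
Proof.
apply/seteqP; split=> [_ [A _ <-]|_ ->] /=; first by rewrite big_ord0.
have A : 'I_0 -> 'M[K]_d by case.
by exists A; [case | rewrite big_ord0].
Qed.

Lemma productsS M k : products k.+1 M = [set A *m S | A in M & S in products k M].
Proof.
apply/seteqP; split=> [_ [F FM <-]|_ [A MA [_ [F FM <-] <-]]].
  exists (F ord_max) => //.
  exists (\big[mulmx/1%:M]_(j < k) F (widen_ord (leqnSn k) (rev_ord j))).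
    by exists (F \o widen_ord (leqnSn k)) => // j; exact: FM.
  rewrite big_ord_recl; congr (F _ *m _); first by apply: val_inj; rewrite /= subn1.
  by apply: eq_bigr => j _; congr F; apply: val_inj; rewrite /= /bump subSS.
exists (fun i : 'I_k.+1 => if unlift ord_max i is Some j then F j else A).
  by move=> i /=; case: unliftP.
rewrite big_ord_recl; congr (_ *m _).
  case: unliftP => //= j /(congr1 val) /=; rewrite /bump leqNgt ltn_ord add0n subn1 /=.
  by move=> kj; have := ltn_ord j; rewrite -kj ltnn.
apply: eq_bigr => i _; case: unliftP => [j|] /(congr1 val) /=.
  rewrite /bump [(k <= j)%N]leqNgt ltn_ord !add0n add1n subSS => ij.
  by congr F; apply: val_inj.
rewrite /bump /= add1n subSS => ik; have := ltn_ord (rev_ord i); by rewrite /= ik ltnn.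
Qed.

Lemma products_nonempty M k : M !=set0 -> products k M !=set0.
Proof. by move=> [A MA]; exists (\big[mulmx/1%:M]_(j < k) A), (fun=> A). Qed.

Lemma products1 M : products 1 M = M.
Proof.
rewrite productsS products0; apply/seteqP; split=> [_ [A MA [_ -> <-]]|A MA].
  by rewrite mulmx1.
by exists A => //; exists 1%:M => //; rewrite mulmx1.
Qed.

Lemma productsD M k l :
  products (k + l) M = [set S *m S' | S in products k M & S' in products l M].
Proof.
elim: k => [|k IH].
  rewrite products0 add0n; apply/seteqP; split=> [S MS|_ [_ -> [S MS <-]]].
    by exists 1%:M => //; exists S => //; rewrite mul1mx.
  by rewrite mul1mx.
rewrite addSn !productsS IH; apply/seteqP; split.
  move=> _ [A MA [_ [S MS [S' MS' <-]] <-]].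
  by exists (A *m S); [exists A => //; exists S|exists S' => //; rewrite mulmxA].
move=> _ [_ [A MA [S MS <-]] [S' MS' <-]].
by exists A => //; exists (S *m S'); [exists S => //; exists S'|rewrite mulmxA].
Qed.

Lemma products_mul M k l S S' :
  products k M S -> products l M S' -> products (k + l) M (S *m S').
Proof. by move=> MS MS'; rewrite productsD; exists S => //; exists S'. Qed.

End products.

(** * The joint spectral radius as the least growth rate *)

Lemma near_geometric_le (R : realType) (C a b : R) : 0 < a -> a < b ->
  \forall k \near \oo, C * a ^+ k <= b ^+ k.
Proof.
move=> a0 ab; have b0 := lt_trans a0 ab.
have lt1 : `|a / b| < 1.
  by rewrite ger0_norm ?divr_ge0 ?(ltW a0) ?(ltW b0)// ltr_pdivrMr// mul1r.
have /cvgrPdist_lt /(_ 1 ltr01) := cvg_geometric C lt1.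
apply: filterS => k; rewrite /geometric /= sub0r normrN => /ltW /(le_trans (ler_norm _)).
by rewrite exprMn exprVn mulrA ler_pdivrMr ?exprn_gt0// mul1r.
Qed.

Lemma powR_invn_le (R : realType) (x y : R) k : (0 < k)%N -> 0 <= x -> 0 <= y ->
  x <= y ^+ k -> x `^ k%:R^-1 <= y.
Proof.
move=> k0 x0 y0 xy.
have -> : y = (y ^+ k) `^ k%:R^-1.
  by rewrite -powR_mulrn// -powRrM mulfV ?powRr1// pnatr_eq0 -lt0n.
by apply: ge0_ler_powR; rewrite ?invr_ge0 ?ler0n ?nnegrE ?exprn_ge0.
Qed.

Lemma le_powR_invn (R : realType) (x y : R) k : (0 < k)%N -> 0 <= y ->
  y ^+ k <= x -> y <= x `^ k%:R^-1.
Proof.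
move=> k0 y0 xy.
have {1}-> : y = (y ^+ k) `^ k%:R^-1.
  by rewrite -powR_mulrn// -powRrM mulfV ?powRr1// pnatr_eq0 -lt0n.
have x0 : 0 <= x by apply: le_trans xy; rewrite exprn_ge0.
by apply: ge0_ler_powR; rewrite ?invr_ge0 ?ler0n ?nnegrE ?exprn_ge0.
Qed.

Section growth.
Context {R : realType} {s : scalar_kind} {d : nat}.
Local Notation K := (scalars R s).
Implicit Types (M N : set 'M[K]_d) (A B S : 'M[K]_d) (k l : nat) (r C : R).

Definition growth_bound M C r :=
  forall k S, products k M S -> entry_norm S <= C * r ^+ k.

Definition growth_rates M : set R :=
  [set r | 0 < r /\ exists C, growth_bound M C r].

Lemma growth_bound_ge0 M C r : growth_bound M C r -> 0 <= C.
Proof.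
move=> /(_ 0 1%:M); rewrite products0 expr0 mulr1 => h.
exact: le_trans (entry_norm_ge0 _) (h erefl).
Qed.

Lemma growth_bound_expn M c : (forall A, M A -> entry_norm A <= c) ->
  growth_bound M (entry_norm (1%:M : 'M[K]_d)) c.
Proof.
move=> Mc; elim=> [|k IH] S; first by rewrite products0 => ->; rewrite mulr1.
rewrite productsS => -[A MA [T MT <-]]; apply: le_trans (entry_normM _ _) _.
rewrite exprS mulrCA; apply: ler_pM; rewrite ?entry_norm_ge0//; first exact: Mc.
exact: IH.
Qed.

Lemma growth_rates_upward M r t : growth_rates M r -> r <= t -> growth_rates M t.
Proof.
move=> [r0 [C MC]] rt; split; first exact: lt_le_trans rt.
exists C => k S /MC /le_trans; apply; rewrite ler_wpM2l ?(growth_bound_ge0 MC)//.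
by rewrite lerXn2r// nnegrE ltW// (lt_le_trans r0).
Qed.

(** One length m suffices: a product of any length is cut into blocks of length
    m and a remainder shorter than m, whose norm is bounded by a constant. *)
Lemma growth_rates_of_products M c r m : (0 < m)%N -> 0 < r ->
  (forall A, M A -> entry_norm A <= c) ->
  (forall S, products m M S -> entry_norm S <= r ^+ m) -> growth_rates M r.
Proof.
move=> m0 r0 Mc Mm; split => //.
(* The bound on the remainder uses c' / r >= 1. *)
set c' := Num.max c r.
have c'r : 1 <= c' / r by rewrite ler_pdivlMr// mul1r le_max lexx orbT.
have c'0 : 0 < c' by rewrite lt_max r0 orbT.
have Mc' A : M A -> entry_norm A <= c' by move=> /Mc /le_trans -> //; rewrite le_max lexx.
exists (entry_norm (1%:M : 'M[K]_d) * (c' / r) ^+ m) => k.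
elim/ltn_ind: k => k IH S; have [km|mk] := ltnP k m.
  move=> /(growth_bound_expn Mc') /le_trans; apply.
  rewrite -mulrA ler_wpM2l ?entry_norm_ge0//.
  rewrite -[c' in leLHS](@divfK _ r) ?gt_eqF// exprMn ler_wpM2r// ?exprn_ge0 ?(ltW r0)//.
  by apply: ler_weXn2l => //; exact: ltnW.
rewrite -(subnK mk) addnC productsD => -[S1 MS1 [S2 MS2 <-]].
apply: le_trans (entry_normM _ _) _; rewrite exprD mulrCA.
apply: ler_pM; rewrite ?entry_norm_ge0//; first exact: Mm.
by apply: IH => //; rewrite -subn_gt0 subKn.
Qed.

Section limit.
Variables (M : set 'M[K]_d) (c : R).
Hypotheses (M0 : M !=set0) (c0 : 0 < c).
Hypothesis Mc : forall A, M A -> entry_norm A <= c.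

Lemma has_inf_growth_rates : has_inf (growth_rates M).
Proof.
split; last by exists 0 => r [/ltW].
by exists c; split => //; eexists; exact: growth_bound_expn Mc.
Qed.

Let sup_norm k := sup [set spectral_norm S | S in products k M].

Let has_sup_norm k : has_sup [set spectral_norm S | S in products k M].
Proof.
split; first by have [S MS] := products_nonempty k M0; exists (spectral_norm S), S.
exists (entry_norm (1%:M : 'M[K]_d) * c ^+ k) => _ [S MS <-].
exact: le_trans (spectral_norm_le_entry_norm _) (growth_bound_expn Mc MS).
Qed.

Let sup_norm_ge0 k : 0 <= sup_norm k.
Proof.
have [S MS] := products_nonempty k M0.
apply: le_trans (spectral_norm_ge0 S) _; apply: ub_le_sup; last by exists S.
by case: (has_sup_norm k).
Qed.

Let sup_norm_le k C : (forall S, products k M S -> entry_norm S <= C) -> sup_norm k <= C.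
Proof.
move=> h; apply: ge_sup; first by case: (has_sup_norm k).
by move=> _ [S /h MS <-]; exact: le_trans (spectral_norm_le_entry_norm _) MS.
Qed.

Let entry_norm_le_sup k S : products k M S -> entry_norm S <= (d * d)%:R * sup_norm k.
Proof.
move=> MS; apply: le_trans (entry_norm_le_spectral_norm _) _.
rewrite ler_wpM2l ?ler0n//; apply: ub_le_sup; last by exists S.
by case: (has_sup_norm k).
Qed.

(** A growth rate r bounds the k-th root of C r^k, hence the limes superior.
    Conversely, if the k-th root is below y < L for a single large k, then
    [growth_rates_of_products] gives a growth rate below L: the constant d^2
    comparing the two norms is absorbed by moving from y = L - e to L - e / 2. *)
Lemma cvg_joint_spectral_radius :
  (fun k => sup [set spectral_norm S | S in products k M] `^ (k%:R^-1)) @ \oo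
    --> inf (growth_rates M).
Proof.
have near_gt0 : \forall k \near \oo, (0 < k)%N by exact: nbhs_infty_gt.
set L := inf _; have L0 : 0 <= L.
  by apply: lb_le_inf; [case: has_inf_growth_rates | move=> r [/ltW]].
apply/(@cvgrPdist_le R R^o) => e e0.
have upper : \forall k \near \oo, sup_norm k `^ (k%:R^-1) <= L + e.
  have [r [r0 [C MC]] rLe] : exists2 r, growth_rates M r & r < L + e.
    by apply: inf_lt; [case: has_inf_growth_rates | rewrite ltrDl].
  near=> k; apply: powR_invn_le; first by near: k.
  - exact: sup_norm_ge0.
  - by rewrite addr_ge0// ltW.
  apply: sup_norm_le => S /MC /le_trans; apply; near: k; exact: near_geometric_le.
have lower : \forall k \near \oo, L - e <= sup_norm k `^ (k%:R^-1).
  have [Le|eL] := leP L e.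
    by near=> k; apply: le_trans (powR_ge0 _ _); rewrite subr_le0.
  have [y0 yL] : 0 < L - e /\ L - e < L - e / 2 by split; lra.
  near=> k; apply: le_powR_invn; [by near: k | exact: ltW |].
  rewrite leNgt; apply/negP => small.
  have : L <= L - e / 2; last by lra.
  apply: ge_inf; first by case: has_inf_growth_rates.
  apply: (growth_rates_of_products (m := k) (c := c)) => //; [by near: k | by lra |].
  move=> S /entry_norm_le_sup /le_trans; apply.
  apply: (@le_trans _ _ ((d * d)%:R * (L - e) ^+ k)).
    by rewrite ler_wpM2l ?ler0n// ltW.
  near: k; exact: near_geometric_le.
near=> k; rewrite ler_distlC -/(sup_norm k); apply/andP; split.
  by near: k.
by near: k.
Unshelve. all: by end_near. Qed.

Lemma joint_spectral_radiusE : joint_spectral_radius M = inf (growth_rates M).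
Proof. exact: (cvg_lim (@Rhausdorff R) cvg_joint_spectral_radius). Qed.

Lemma joint_spectral_radius_ge0 : 0 <= joint_spectral_radius M.
Proof.
rewrite joint_spectral_radiusE.
by apply: lb_le_inf; [case: has_inf_growth_rates | move=> r [/ltW]].
Qed.

Lemma joint_spectral_radius_le r : growth_rates M r -> joint_spectral_radius M <= r.
Proof.
by rewrite joint_spectral_radiusE => Mr; apply: ge_inf => //; case: has_inf_growth_rates.
Qed.

Lemma growth_rates_gt r : joint_spectral_radius M < r -> growth_rates M r.
Proof.
rewrite joint_spectral_radiusE => /inf_lt[]; first by case: has_inf_growth_rates.
by move=> t Mt /ltW; exact: growth_rates_upward.
Qed.

End limit.
End growth.

(** * Bochi's inequality for 2 x 2 matrices *)

Lemma exists_modulus (R : realType) (s : scalar_kind) (x : R) : 0 <= x ->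
  exists u : scalars R s, modulus u = x.
Proof.
move=> x0; case: s; first by exists x; exact: ger0_norm.
by exists (real_complex R x); rewrite /= expr0n addr0 sqrtr_sqr ger0_norm.
Qed.

Lemma sum_ord2 (V : nmodType) (i i' : 'I_2) (F : 'I_2 -> V) : i != i' ->
  \sum_k F k = F i + F i'.
Proof.
move=> ii'; rewrite (bigD1 i) //= (bigD1 i') 1?eq_sym//= big1 ?addr0// => k.
move: ii'; case: i i' k => [[|[|//]] ?] [[|[|//]] ?] [[|[|//]] ?]; by rewrite -!val_eqE.
Qed.

Section bochi.
Context {R : realType} {s : scalar_kind}.
Local Notation K := (scalars R s).
Implicit Types (M : set 'M[K]_2) (A S T Z : 'M[K]_2) (e f x z g : 'cV[K]_2).

Lemma modulusB (u v : K) : modulus (u - v) <= modulus u + modulus v.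
Proof. by rewrite -[modulus v]modulusN modulusD. Qed.

Lemma modulusM_le (u v : K) (t : R) : modulus u <= t -> modulus v <= 1 ->
  modulus (u * v) <= t.
Proof.
move=> ut v1; rewrite modulusM; apply: le_trans ut.
by rewrite ler_piMr ?modulus_ge0.
Qed.

Lemma entry_norm_ord2 (i i' : 'I_2) A : i != i' ->
  entry_norm A = modulus (A i i) + modulus (A i i') +
    (modulus (A i' i) + modulus (A i' i')).
Proof. by move=> ii'; rewrite /entry_norm (sum_ord2 _ ii') !(sum_ord2 _ ii'). Qed.

Definition bounded_in_basis e f t A := exists a b c d : K,
  [/\ A *m e = a *: e + b *: f, A *m f = c *: e + d *: f,
      modulus a <= t, modulus b <= t & modulus c <= t /\ modulus d <= t].

(** Z carries the part of A that t does not control; asking for a bound on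
    T *m Z makes that part harmless in a product, see [split_along_mul]. *)
Definition split_along Z t A := exists T (beta : K),
  [/\ A = T + beta *: Z, modulus beta <= entry_norm A,
      entry_norm T <= 8 * t & entry_norm (T *m Z) <= 8 * t].

(** With z = (1, p) and g = (q, w) in the coordinates i, i', let Z be the
    matrix of range and kernel spanned by z, normalised so that its entry at
    (i, i') is 1. Subtracting beta Z with beta = A i i' leaves
      T = [a + q b, 0; p (a - d) + (w + p q) b, d - q b],
    whose entries are bounded by the coordinates a, b, c, d without division by
    the determinant w - p q, however small that is. *)
Lemma split_along_normalized (i i' : 'I_2) z g : i != i' ->
  z i 0 = 1 -> modulus (z i' 0) <= 1 ->
  modulus (g i 0) <= 1 -> modulus (g i' 0) <= 1 ->
  g i' 0 - z i' 0 * g i 0 != 0 ->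
  exists2 Z, Z *m Z = 0 &
    forall t A, bounded_in_basis z g t A -> split_along Z t A.
Proof.
move=> ii' zi; set p := z i' 0; set q := g i 0; set w := g i' 0 => p1 q1 w1 delta0.
have i'i : i' == i = false by rewrite eq_sym (negbTE ii').
pose y : 'rV[K]_2 := \row_l (if l == i then - p else 1).
have yi : y 0 i = - p by rewrite mxE eqxx.
have yi' : y 0 i' = 1 by rewrite mxE i'i.
have ZE k l : (z *m y) k l = z k 0 * y 0 l by rewrite mxE big_ord1.
have ZZ : (z *m y) *m (z *m y) = 0.
  rewrite -mulmxA [y *m (z *m y)]mulmxA.
  suff -> : y *m z = 0 by rewrite mul0mx mulmx0.
  apply/matrixP => k l; rewrite !ord1 !mxE (sum_ord2 _ ii') yi yi' zi -/p; ring.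
exists (z *m y) => // t A [a [b [c [d [Az Ag at_ bt [ct dt]]]]]].
have t0 : 0 <= t by apply: le_trans at_; exact: modulus_ge0.
have rowA (v u : 'cV[K]_2) (h1 h2 : K) k : A *m v = h1 *: z + h2 *: u ->
    A k i * v i 0 + A k i' * v i' 0 = h1 * z k 0 + h2 * u k 0.
  by move/matrixP/(_ k 0); rewrite !mxE (sum_ord2 _ ii').
have E1 := rowA _ _ _ _ i Az; have E2 := rowA _ _ _ _ i' Az.
have E3 := rowA _ _ _ _ i Ag; have E4 := rowA _ _ _ _ i' Ag.
clear rowA; rewrite zi -/p -/q -/w ?mulr1 in E1 E2 E3 E4.
have Aii : A i i = a + b * q - A i i' * p by rewrite -E1; ring.
have Ai'i : A i' i = a * p + b * w - A i' i' * p by rewrite -E2; ring.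
(* The determinant is cancelled, not divided by, so its size never enters. *)
have Ai'i' : A i' i' = d - q * b + p * A i i'.
  apply: (mulIf delta0).
  have E : A i' i * q + A i' i' * w = (A i i * q + A i i' * w - d * q) * p + d * w.
    by rewrite E4 E3; ring.
  rewrite Aii Ai'i in E.
  apply/eqP; rewrite -subr_eq0; move/eqP: E; rewrite -subr_eq0 => /eqP E.
  by apply/eqP; rewrite -[RHS]E; ring.
exists (A - A i i' *: (z *m y)), (A i i'); split.
- by rewrite subrK.
- exact: modulus_le_entry_norm.
- have -> : 8 * t = (t + t) + 0 + ((t + t) + (t + t) + (t + t)) by ring.
  rewrite (entry_norm_ord2 _ ii') !mxE !big_ord1 yi yi' zi -/p.
  rewrite (_ : A i i - _ = a + b * q); last by rewrite Aii; ring.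
  rewrite (_ : A i i' - _ = 0) ?modulus0; last by ring.
  rewrite (_ : A i' i - _ = (a * p - d * p) + (b * w + b * q * p)); last first.
    by rewrite Ai'i Ai'i'; ring.
  rewrite (_ : A i' i' - _ = d - b * q); last by rewrite Ai'i'; ring.
  apply: lerD; [apply: lerD => //|apply: lerD].
  + by apply: le_trans (modulusD _ _) (lerD _ _) => //; exact: modulusM_le.
  + apply: le_trans (modulusD _ _) (lerD _ _).
      by apply: le_trans (modulusB _ _) (lerD _ _); exact: modulusM_le.
    apply: le_trans (modulusD _ _) (lerD _ _); first exact: modulusM_le.
    by apply: modulusM_le => //; exact: modulusM_le.
  + by apply: le_trans (modulusB _ _) (lerD _ _) => //; exact: modulusM_le.
- rewrite mulmxBl -scalemxAl ZZ scaler0 subr0 mulmxA Az.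
  have -> : 8 * t = ((t + t) + (t + t)) * (1 + 1) by ring.
  apply: le_trans (entry_normM _ _) _; apply: ler_pM; rewrite ?entry_norm_ge0//.
    rewrite /entry_norm (sum_ord2 _ ii') !big_ord1 !mxE zi -/p -/q -/w mulr1.
    apply: lerD; apply: le_trans (modulusD _ _) (lerD _ _) => //; exact: modulusM_le.
  by rewrite /entry_norm big_ord1 (sum_ord2 _ ii') yi yi' modulusN modulus1 lerD2r.
Qed.

Definition det2 e f : K := e 0 0 * f 1 0 - e 1 0 * f 0 0.

Lemma det2_ord2 (i i' : 'I_2) e f : i != i' ->
  det2 e f != 0 -> e i 0 * f i' 0 - e i' 0 * f i 0 != 0.
Proof.
have o0 h : @Ordinal 2 0 h = 0 by apply: val_inj.
have o1 h : @Ordinal 2 1 h = 1 by apply: val_inj.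
case: i i' => [[|[|//]] ?] [[|[|//]] ?]; rewrite -val_eqE //= !(o0, o1) // => _.
by rewrite -oppr_eq0 opprB.
Qed.

Lemma det2_cramer e f x : det2 e f *: x = det2 x f *: e + det2 e x *: f.
Proof.
apply/matrixP => k l; rewrite !ord1 !mxE /det2.
have [->|->] : k = 0 \/ k = 1 by case: k => [[|[|//]] ?]; [left|right]; exact: val_inj.
  ring.
ring.
Qed.

(** Dividing both vectors by the dominant coordinate e i normalises the basis,
    and does not change the coordinates of A. *)
Lemma split_along_dominant (i : 'I_2) e f : det2 e f != 0 ->
  (forall k, modulus (e k 0) <= modulus (e i 0)) ->
  (forall k, modulus (f k 0) <= modulus (e i 0)) ->
  exists2 Z, Z *m Z = 0 &
    forall t A, bounded_in_basis e f t A -> split_along Z t A.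
Proof.
move=> ef0 ei fi; pose i' := rev_ord i.
have ii' : i != i' by rewrite /i'; case: (i) => [[|[|//]] ?]; rewrite -val_eqE.
have ei0 : e i 0 != 0.
  apply: contraNneq ef0 => ei0.
  have e0 k : e k 0 = 0.
    apply: modulus_eq0; apply/eqP; rewrite eq_le modulus_ge0 andbT.
    by rewrite (le_trans (ei k))// ei0 modulus0.
  by rewrite /det2 !e0; apply/eqP; ring.
set u := (e i 0)^-1.
have uP : u != 0 by rewrite invr_eq0.
have mu (v : K) : modulus v <= modulus (e i 0) -> modulus (u * v) <= 1.
  move=> /(ler_wpM2l (modulus_ge0 u)); rewrite -!modulusM mulVf//.
  by rewrite modulus1.
have [|||||| Z ZZ h] := @split_along_normalized i i' (u *: e) (u *: f).
- exact: ii'.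
- by rewrite mxE mulVf.
- by rewrite mxE mu.
- by rewrite mxE mu.
- by rewrite mxE mu.
- rewrite !mxE (_ : _ - _ = u ^+ 2 * (e i 0 * f i' 0 - e i' 0 * f i 0)).
    by rewrite mulf_neq0 ?expf_neq0// det2_ord2.
  by rewrite -[u * f i' 0]mul1r -[X in X * (u * f i' 0)](mulVf ei0) -/u; ring.
exists Z => // t A [a [b [c [d [Ae Af h1 h2 h3]]]]]; apply: h; exists a, b, c, d.
by split=> //; rewrite -scalemxAr ?Ae ?Af scalerDr !scalerA ![u * _]mulrC.
Qed.

Lemma bounded_in_basisC e f t A :
  bounded_in_basis e f t A -> bounded_in_basis f e t A.
Proof.
move=> [a [b [c [d [Ae Af h1 h2 [h3 h4]]]]]]; exists d, c, b, a.
by split=> //; rewrite addrC.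
Qed.

Lemma split_along_exists e f : det2 e f != 0 ->
  exists2 Z, Z *m Z = 0 &
    forall t A, bounded_in_basis e f t A -> split_along Z t A.
Proof.
move=> ef0.
have fe0 : det2 f e != 0.
  rewrite -oppr_eq0 (_ : - _ = det2 e f)//; rewrite /det2; ring.
have [[[] i] _ max] := @Order.TotalTheory.arg_maxP _ _ _ (true, ord0 : 'I_2) xpredT
  (fun bk => modulus (if bk.1 then e bk.2 0 else f bk.2 0)) isT.
  apply: (split_along_dominant (i := i)) => // k; first exact: (max (true, k)).
  exact: (max (false, k)).
have [k|k|Z ZZ h] := split_along_dominant (i := i) fe0.
- exact: (max (false, k)).
- exact: (max (true, k)).
by exists Z => // t A /bounded_in_basisC; exact: h.
Qed.

(** A A' = A T' + beta' T Z, because the term beta beta' Z Z vanishes. *)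
Lemma split_along_mul Z t t' A A' : Z *m Z = 0 ->
  split_along Z t A -> split_along Z t' A' ->
  entry_norm (A *m A') <= 8 * (t' * entry_norm A + t * entry_norm A').
Proof.
move=> ZZ [T [b [AE bA hT hTZ]]] [T' [b' [AE' bA' hT' hTZ']]].
have -> : A *m A' = A *m T' + b' *: (T *m Z).
  rewrite {1}AE' mulmxDr; congr (_ + _); rewrite -scalemxAr AE mulmxDl.
  by rewrite -scalemxAl ZZ scaler0 addr0.
have -> : 8 * (t' * entry_norm A + t * entry_norm A') =
  entry_norm A * (8 * t') + entry_norm A' * (8 * t) by ring.
apply: le_trans (entry_normD _ _) (lerD _ _).
  by apply: le_trans (entry_normM _ _) _; rewrite ler_wpM2l ?entry_norm_ge0.
by rewrite entry_normZ; apply: ler_pM; rewrite ?modulus_ge0 ?entry_norm_ge0.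
Qed.

Section basis.
Variables (M : set 'M[K]_2) (r C : R).
Hypotheses (r0 : 0 < r) (MC : growth_bound M C r).

(** The unit ball of the norm x |-> sup |S x| / r^k, which contracts under A / r
    for every A in M. *)
Let W := [set x : 'cV[K]_2 | forall k S, products k M S -> entry_norm (S *m x) <= r ^+ k].

Let W_orbit k S x (u : K) : products k M S -> W x -> modulus u = (r ^+ k)^-1 ->
  W (u *: (S *m x)).
Proof.
move=> MS Wx uk l S' MS'; rewrite -scalemxAr entry_normZ uk mulmxA.
rewrite mulrC ler_pdivrMr ?exprn_gt0// -exprD; apply: Wx; exact: products_mul.
Qed.

Let dets := [set modulus (det2 ef.1 ef.2) | ef in [set ef | W ef.1 /\ W ef.2]].

Let modulus_det2_le e f : W e -> W f -> modulus (det2 e f) <= 1.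
Proof.
have W1 x : W x -> modulus (x 0 0) + modulus (x 1 0) <= 1.
  move=> /(_ 0 1%:M); rewrite products0 mul1mx expr0 => /(_ erefl).
  by rewrite /entry_norm (@sum_ord2 _ 0 1)// !big_ord1.
move=> /W1 We /W1 Wf; apply: le_trans (modulusB _ _) _; rewrite !modulusM.
have [a0 b0] := (modulus_ge0 (e 0 0), modulus_ge0 (e 1 0)).
have [c0 d0] := (modulus_ge0 (f 0 0), modulus_ge0 (f 1 0)).
nra.
Qed.

Let small_basis : exists e f, [/\ W e, W f & det2 e f != 0].
Proof.
have C0 := growth_bound_ge0 MC.
have C10 : 0 <= (C + 1)^-1 by rewrite invr_ge0; lra.
have [u uC] := exists_modulus s C10.
have Wu i : W (u *: delta_mx i 0).
  move=> k S MS; rewrite -scalemxAr entry_normZ uC mulrC ler_pdivrMr; last by lra.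
  apply: le_trans (entry_normM _ _) _.
  have -> : entry_norm (delta_mx i 0 : 'cV[K]_2) = 1.
    rewrite /entry_norm (bigD1 i) //= big_ord1 mxE !eqxx modulus1 big1 ?addr0// => j ji.
    by rewrite big_ord1 mxE (negbTE ji) modulus0.
  rewrite mulr1; apply: le_trans (MC MS) _.
  by rewrite mulrC ler_wpM2l ?exprn_ge0 ?(ltW r0)// lerDl.
exists (u *: delta_mx 0 0), (u *: delta_mx 1 0); split=> //.
rewrite /det2 !mxE /= !mulr1 !mulr0 subr0 mulf_neq0//.
all: by apply/eqP => u0; move: uC; rewrite u0 modulus0 => /esym/eqP; rewrite invr_eq0; lra.
Qed.

(** Take e, f in W whose determinant is within a factor c of the supremum. By
    Cramer's rule the coordinates of S e are quotients of determinants of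
    vectors in W, up to the factor r^k, because S e / r^k lies in W. Working
    with a near-maximum, as in Auerbach's lemma but with c > 1, avoids proving
    that W is compact. *)
Lemma near_auerbach_basis (c : R) : 1 < c ->
  exists e f, det2 e f != 0 /\
    forall k S, products k M S -> bounded_in_basis e f (c * r ^+ k) S.
Proof.
move=> c1; have c0 : 0 < c by lra.
have [e0 [f0 [We0 Wf0 ef0]]] := small_basis.
have dets_sup : has_sup dets.
  split; first by exists (modulus (det2 e0 f0)), (e0, f0).
  by exists 1 => _ [[e f] [We Wf] <-]; exact: modulus_det2_le.
have le_dets e f : W e -> W f -> modulus (det2 e f) <= sup dets.
  by move=> We Wf; apply: ub_le_sup; [case: dets_sup | exists (e, f)].
have Q0 : 0 < sup dets.
  apply: lt_le_trans (le_dets _ _ We0 Wf0); rewrite lt_neqAle modulus_ge0 andbT.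
  by apply: contra ef0 => /eqP/esym/modulus_eq0 ->.
have [_ [[e f] /= [We Wf] <-] Qef] : exists2 q, dets q & sup dets / c < q.
  apply: sup_gt; first by case: dets_sup.
  by rewrite ltr_pdivrMr// ltr_pMr.
have efgt0 : 0 < modulus (det2 e f) by apply: lt_trans Qef; rewrite divr_gt0.
have ef : det2 e f != 0 by apply: contraTneq efgt0 => ->; rewrite modulus0 ltxx.
exists e, f; split=> // k S MS.
have rk0 : 0 < r ^+ k by rewrite exprn_gt0.
have [u uk] := @exists_modulus R s (r ^+ k)^-1 (ltW (eqbRL (invr_gt0 _) rk0)).
have bound (v : K) : modulus (u * v) <= sup dets ->
    modulus (v / det2 e f) <= c * r ^+ k.
  rewrite modulusM uk mulrC ler_pdivrMr// => vQ.
  have -> : modulus (v / det2 e f) = modulus v / modulus (det2 e f).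
    apply: (mulIf (lt0r_neq0 efgt0)); rewrite divfK ?gt_eqF//.
    by rewrite -modulusM divfK.
  rewrite ler_pdivrMr//; apply: le_trans vQ _; rewrite mulrAC ler_wpM2r ?(ltW rk0)//.
  by move/ltW: Qef; rewrite ler_pdivrMr// mulrC.
have det2Zl (a : K) x y : a * det2 x y = det2 (a *: x) y by rewrite /det2 !mxE; ring.
have det2Zr (a : K) x y : a * det2 x y = det2 x (a *: y) by rewrite /det2 !mxE; ring.
exists (det2 (S *m e) f / det2 e f), (det2 e (S *m e) / det2 e f),
  (det2 (S *m f) f / det2 e f), (det2 e (S *m f) / det2 e f).
have coord x : x = (det2 x f / det2 e f) *: e + (det2 e x / det2 e f) *: f.
  apply: (can_inj (scalerK ef)); rewrite det2_cramer scalerDr !scalerA.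
  by rewrite ![det2 e f * _]mulrC !divfK.
split; [exact: coord|exact: coord|..]; last split.
all: apply: bound; rewrite ?(det2Zl _ _ f) ?(det2Zr _ e); apply: le_dets => //.
all: exact: W_orbit MS _ uk.
Qed.

(** The basis depends on c > 1 but the resulting inequality only through the
    factor c, which tends to 1. *)
Lemma entry_norm_products_mul k l S S' : products k M S -> products l M S' ->
  entry_norm (S *m S') <= 8 * (r ^+ l * entry_norm S + r ^+ k * entry_norm S').
Proof.
move=> MS MS'; set B := 8 * _.
have B0 : 0 <= B.
  by rewrite !(mulr_ge0, addr_ge0)// ?entry_norm_ge0// exprn_ge0// ltW.
apply/ler_addgt0Pr => h h0.
have B1 : 0 < B + 1 by rewrite ltr_wpDl.
have c1 : 1 < 1 + h / (B + 1) by rewrite ltrDl divr_gt0.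
have [e [f [ef basis]]] := near_auerbach_basis c1.
have [Z ZZ splitZ] := split_along_exists ef.
have := split_along_mul ZZ (splitZ _ _ (basis _ _ MS)) (splitZ _ _ (basis _ _ MS')).
move=> /le_trans; apply.
have -> : 8 * ((1 + h / (B + 1)) * r ^+ l * entry_norm S +
    (1 + h / (B + 1)) * r ^+ k * entry_norm S') = B + B * (h / (B + 1)).
  by rewrite /B; ring.
by rewrite lerD2l mulrA ler_pdivrMr// mulrC ler_wpM2l ?(ltW h0)// lerDl.
Qed.
End basis.
End bochi.

(** * Polynomial growth with uniform constants *)

Lemma bernoulli_ineq (R : realDomainType) (x : R) n : 0 <= x -> 1 + n%:R * x <= (1 + x) ^+ n.
Proof.
move=> x0; elim: n => [|n IH]; first by rewrite mul0r addr0.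
rewrite exprS; apply: (@le_trans _ _ ((1 + x) * (1 + n%:R * x))).
  rewrite -subr_ge0 -natr1; have -> : (1 + x) * (1 + n%:R * x) - (1 + (n%:R + 1) * x) =
    n%:R * x * x by ring.
  by rewrite !mulr_ge0.
by rewrite ler_wpM2l// addr_ge0.
Qed.

Section polynomial_growth.
Context {R : realType} {s : scalar_kind}.
Local Notation K := (scalars R s).
Variables (M : set 'M[K]_2) (r c : R).
Hypotheses (r0 : 0 < r) (Mr : exists C, growth_bound M C r).
Hypothesis Mc : forall A, M A -> entry_norm A <= c.

Lemma entry_norm_products_dyadic n k S : (0 < k <= 2 ^ n)%N -> products k M S ->
  entry_norm S <= 16 ^+ n * (c / r) * r ^+ k.
Proof.
have [C MC] := Mr; elim: n k S => [|n IH] k S.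
  have -> : (0 < k <= 2 ^ 0)%N = (k == 1)%N by rewrite expn0; lia.
  by move=> /eqP ->; rewrite products1 mul1r expr1 divfK ?gt_eqF//; exact: Mc.
move=> /andP[k0 kn] MS.
have c0 : 0 <= c.
  case: k k0 MS {kn} => // k _; rewrite productsS => -[A MA _].
  exact: le_trans (entry_norm_ge0 A) (Mc MA).
have [kn'|nk] := leqP k (2 ^ n).
  apply: le_trans (IH k S _ MS) _; first by rewrite k0.
  rewrite ler_wpM2r ?exprn_ge0 ?(ltW r0)// ler_wpM2r ?divr_ge0 ?(ltW r0)//.
  by rewrite exprS ler_peMl ?exprn_ge0// ler1n.
have [l lk] : exists l, k = (2 ^ n + l)%N by exists (k - 2 ^ n)%N; rewrite subnKC// ltnW.
have l0 : (0 < l <= 2 ^ n)%N by move: nk kn; rewrite lk expnS; lia.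
move: MS; rewrite lk productsD => -[S1 MS1 [S2 MS2 <-]].
apply: le_trans (entry_norm_products_mul r0 MC MS1 MS2) _.
have n0 : (0 < 2 ^ n <= 2 ^ n)%N by rewrite expn_gt0 leqnn.
have h1 := IH _ _ n0 MS1; have h2 := IH _ _ l0 MS2.
set X := 16 ^+ n * _ in h1 h2.
have -> : 16 ^+ n.+1 * (c / r) * r ^+ (2 ^ n + l) =
    8 * (r ^+ l * (X * r ^+ (2 ^ n)) + r ^+ (2 ^ n) * (X * r ^+ l)).
  by rewrite /X exprD exprS; ring.
rewrite ler_wpM2l// lerD//; by rewrite ler_wpM2l// exprn_ge0// ltW.
Qed.

(** A power of two between k and 2 k turns the dyadic bound into
    16 k^4 (c / r) r^k, and (k h)^4 <= (1 + h)^(4 k) by Bernoulli's inequality. *)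
Lemma growth_bound_polynomial (h : R) : 0 < h -> h <= 1 -> h <= r -> 1 <= c ->
  growth_bound M (16 * c / h ^+ 5) (r * (1 + h) ^+ 4).
Proof.
move=> h0 h1 hr c1 k S MS; have hh0 := exprn_gt0 5 h0.
move: MS; have [->|k0] := posnP k => MS.
  move: MS; rewrite products0 => ->; rewrite expr0 mulr1 ler_pdivlMr//.
  have -> : entry_norm (1%:M : 'M[K]_2) = 2.
    rewrite (@entry_norm_ord2 _ _ 0 1)// !mxE /= modulus0 modulus1; ring.
  have : h ^+ 5 <= 1 by rewrite exprn_ile1// ltW.
  lra.
have /andP[tk kt] := trunc_log_bounds (isT : (1 < 2)%N) k0.
set n := (trunc_log 2 k).+1 in kt.
have kn : (0 < k <= 2 ^ n)%N by rewrite k0 ltnW.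
have n2k : (2 ^ n <= 2 * k)%N by rewrite expnS leq_mul.
apply: le_trans (entry_norm_products_dyadic kn MS) _.
have n16 : 16 ^+ n <= 16 * k%:R ^+ 4 :> R.
  have -> : 16 ^+ n = (2 ^ n)%:R ^+ 4 :> R.
    by rewrite natrX -exprM mulnC exprM; congr (_ ^+ _); rewrite -natrX.
  have -> : 16 * k%:R ^+ 4 = (2 * k)%:R ^+ 4 :> R by rewrite natrM; ring.
  by rewrite lerXn2r ?nnegrE ?ler0n// ler_nat.
have k4 : k%:R ^+ 4 * h ^+ 4 <= ((1 + h) ^+ 4) ^+ k.
  rewrite -exprMn -exprM mulnC exprM lerXn2r ?nnegrE//.
  - by rewrite mulr_ge0 ?ler0n ?ltW.
  - by rewrite exprn_ge0//; lra.
  - by apply: le_trans (bernoulli_ineq k (ltW h0)); rewrite lerDr.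
rewrite exprMn [_ * (r ^+ k * _)]mulrCA mulrC ler_wpM2l ?exprn_ge0 ?(ltW r0)//.
have -> : 16 * c / h ^+ 5 * ((1 + h) ^+ 4) ^+ k =
    16 * (((1 + h) ^+ 4) ^+ k / h ^+ 4) * (c / h).
  by field; rewrite gt_eqF.
apply: ler_pM; rewrite ?exprn_ge0 ?divr_ge0//; [by lra|exact: ltW|..].
  apply: le_trans n16 _; rewrite ler_wpM2l// ler_pdivlMr ?exprn_gt0//.
by rewrite ler_wpM2l ?lef_pV2 ?posrE//; lra.
Qed.

End polynomial_growth.

(** * Perturbation of the set of matrices *)

Section perturbation.
Context {R : realType} {s : scalar_kind} {d : nat}.
Local Notation K := (scalars R s).

(** In the norm X |-> sup |S X| / t^l, multiplication by A in M has norm at most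
    t, and that norm is between |X| and C |X|, so that B in N has norm at most
    t + C eta. The proof follows these norms along a product, starting from
    the identity. *)
Lemma growth_bound_perturbation (M N : set 'M[K]_d) (C t eta : R) :
  0 < t -> 0 <= eta -> growth_bound M C t ->
  (forall B, N B -> exists2 A, M A & entry_norm (B - A) <= eta) ->
  growth_bound N C (t + C * eta).
Proof.
move=> t0 eta0 MC near; have C0 := growth_bound_ge0 MC.
have u0 : 0 <= t + C * eta by rewrite addr_ge0 ?mulr_ge0// ltW.
(* The matrices S remain arbitrary in the induction on the length of P. *)
suff orbit k P : products k N P -> forall l S, products l M S ->
    entry_norm (S *m P) <= C * (t + C * eta) ^+ k * t ^+ l.
  move=> k P NP; have := orbit k P NP 0 1%:M; rewrite products0 mul1mx mulr1.
  exact.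
elim: k P => [|k IH] P.
  rewrite products0 => -> l S MS; rewrite mulmx1 mulr1; exact: MC.
rewrite productsS => -[B NB [Q NQ <-]] l S MS; have [A MA BA] := near _ NB.
have -> : S *m (B *m Q) = S *m A *m Q + S *m (B - A) *m Q.
  by rewrite -mulmxDl -mulmxDr addrC subrK mulmxA.
have h1 : entry_norm (S *m A *m Q) <= C * (t + C * eta) ^+ k * t ^+ l.+1.
  by rewrite -addn1; apply: IH => //; apply: products_mul => //; rewrite products1.
have h2 : entry_norm (S *m (B - A) *m Q) <=
    (C * t ^+ l * eta) * (C * (t + C * eta) ^+ k).
  apply: le_trans (entry_normM _ _) _; apply: ler_pM; rewrite ?entry_norm_ge0//.
    apply: le_trans (entry_normM _ _) _; apply: ler_pM; rewrite ?entry_norm_ge0//.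
    exact: MC.
  by have := IH Q NQ 0 1%:M; rewrite products0 mul1mx expr0 mulr1; exact.
apply: le_trans (entry_normD _ _) _; apply: le_trans (lerD h1 h2) _.
by rewrite le_eqVlt; apply/orP; left; apply/eqP; rewrite !exprS; ring.
Qed.

End perturbation.

(** Rate and constant of [growth_bound_polynomial] for r = rho + h: the rate
    exceeds rho by at most (1 + 30 c) h, since (1 + h)^4 <= 1 + 15 h and
    rho + h <= 2 c, and the perturbation adds
    (16 c / h^5) (8 h^6) = 128 c h. *)
Lemma joint_spectral_radius_close (R : realType) (s : scalar_kind)
    (M N : set 'M[scalars R s]_2) (c h : R) :
  M !=set0 -> N !=set0 -> 1 <= c ->
  (forall A, M A -> entry_norm A <= c) -> (forall B, N B -> entry_norm B <= c) ->
  0 < h -> h <= 1 ->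
  (forall B, N B -> exists2 A, M A & entry_norm (B - A) <= 8 * h ^+ 6) ->
  joint_spectral_radius N <= joint_spectral_radius M + 159 * c * h.
Proof.
move=> M0 N0 c1 Mc Nc h0 h1 near; have c0 : 0 < c by lra.
set rho := joint_spectral_radius M.
have rho0 : 0 <= rho := joint_spectral_radius_ge0 M0 c0 Mc.
have rhoc : rho <= c.
  by apply: (joint_spectral_radius_le M0 c0 Mc); split=> //; eexists; exact: growth_bound_expn.
have [r0 Mr] : growth_rates M (rho + h) by apply: (growth_rates_gt M0 c0 Mc); rewrite ltrDl.
have hr : h <= rho + h by rewrite lerDr.
have t0 : 0 < (rho + h) * (1 + h) ^+ 4 by rewrite mulr_gt0 ?exprn_gt0//; lra.
have eta0 : 0 <= 8 * h ^+ 6 by rewrite mulr_ge0 ?exprn_ge0 ?ltW.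
have NC := growth_bound_perturbation t0 eta0
  (growth_bound_polynomial r0 Mr Mc h0 h1 hr c1) near.
have E : (rho + h) * (1 + h) ^+ 4 + 16 * c / h ^+ 5 * (8 * h ^+ 6) =
    (rho + h) * (1 + h) ^+ 4 + 128 * c * h.
  by field; rewrite gt_eqF.
rewrite E in NC.
apply: (@le_trans _ _ ((rho + h) * (1 + h) ^+ 4 + 128 * c * h)).
  apply: (joint_spectral_radius_le N0 c0 Nc); split; last by eexists; exact: NC.
  by rewrite addr_gt0// !mulr_gt0.
have h4 : (1 + h) ^+ 4 <= 1 + 15 * h.
  have -> : (1 + h) ^+ 4 = 1 + h * (4 + 6 * h + 4 * h ^+ 2 + h ^+ 3) by ring.
  rewrite lerD2l mulrC ler_wpM2r ?(ltW h0)//.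
  have : h ^+ 2 <= 1 by rewrite exprn_ile1// ltW.
  have : h ^+ 3 <= 1 by rewrite exprn_ile1// ltW.
  lra.
have : (rho + h) * (1 + h) ^+ 4 <= (rho + h) * (1 + 15 * h) by rewrite ler_wpM2l// ltW.
have : (rho + h) * h <= (2 * c) * h by rewrite ler_wpM2r ?(ltW h0)//; lra.
have : h <= c * h by rewrite ler_peMl// ltW.
lra.
Qed.

(** * Compact sets and the Hausdorff distance *)

Section hausdorff.
Context {R : realType} {s : scalar_kind} {d : nat}.
Local Notation K := (scalars R s).

Lemma hausdorff_dist_near (M N : compacts R s d) (delta : R) (B : 'M[K]_d) :
  hausdorff_dist M N < delta -> compacts_set N B ->
  exists2 A, compacts_set M A & spectral_norm (B - A) < delta.
Proof.
move=> MNdelta NB.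
have [A0 MA0] := compacts_nonempty M.
have [c Nc] := compact_spectral_bounded (@compacts_compact _ _ _ N).
pose dist C := inf [set spectral_norm (A - C) | A in (M : set _)].
have has_inf_dist C : has_inf [set spectral_norm (A - C) | A in (M : set _)].
  split; first by exists (spectral_norm (A0 - C)), A0.
  by exists 0 => _ [A _ <-]; exact: spectral_norm_ge0.
have dist_le : dist B <= sup [set dist C | C in (N : set _)].
  apply: ub_le_sup; last by exists B.
  exists (spectral_norm A0 + c) => _ [C NC <-].
  apply: (@le_trans _ _ (spectral_norm (A0 - C))).
    by apply: ge_inf; [case: (has_inf_dist C) | exists A0].
  by apply: le_trans (spectral_normD _ _) _; rewrite spectral_normN lerD2l Nc.
have : dist B < delta.
  apply: le_lt_trans MNdelta; apply: le_trans dist_le _.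
  by rewrite /hausdorff_dist le_max; apply/orP; right; exact: lexx.
move=> /(inf_lt (has_inf_dist B).1)[_ [A MA <-]]; rewrite spectral_normBC.
by exists A.
Qed.

Lemma compact_hausdorff_bounded (H : set (compacts R s d)) : compact H ->
  exists c, forall M, H M -> forall A, compacts_set M A -> spectral_norm A <= c.
Proof.
move=> /compact_near_coveringP cover.
have [-> |/set0P[M0 _]] := eqVneq H set0; first by exists 0.
have [n _ Hn] : \forall n \near \oo, H `<=` (fun M => hausdorff_dist M0 M < n%:R).
  apply: cover => M _.
  have : \forall n \near \oo, hausdorff_dist M0 M + 1 < n%:R.
    exact: nbhs_infty_gtr.
  move=> near_n; exists (ball M 1, [set n | hausdorff_dist M0 M + 1 < n%:R]).
    by split => //=; exact: nbhsx_ballx.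
  move=> [M' n] /= [MM' Mn]; apply: le_lt_trans Mn.
  apply: le_trans (hausdorff_dist_triangle M M0 M') _; rewrite lerD2l ltW//.
have [c M0c] := compact_spectral_bounded (@compacts_compact _ _ _ M0).
exists (n%:R + c) => M KM A MA.
have [A0 /M0c A0c AA0] := hausdorff_dist_near (Hn n (leqnn n) M KM) MA.
rewrite -[A](subrK A0); apply: le_trans (spectral_normD _ _) (lerD _ _) => //.
exact: ltW.
Qed.
End hausdorff.

(** * Hoelder continuity *)

Lemma joint_spectral_radius_hoelder (R : realType) (s : scalar_kind)
    (M N : compacts R s 2) (c : R) : 1 <= c ->
  (forall A, compacts_set M A -> entry_norm A <= c) ->
  (forall B, compacts_set N B -> entry_norm B <= c) -> M <> N ->
  joint_spectral_radius N <=
    joint_spectral_radius M + 159 * c * hausdorff_dist M N `^ (1 / 6).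
Proof.
move=> c1 Mc Nc MN; set D := hausdorff_dist M N; set h := D `^ (1 / 6).
have c0 : 0 < c by lra.
have [M0 N0] := (compacts_nonempty M, compacts_nonempty N).
have D0 : 0 < D by rewrite /D -mdist_compactsE mdist_gt0; apply/eqP.
have h0 : 0 < h by exact: powR_gt0.
have h6 : h ^+ 6 = D.
  rewrite -powR_mulrn ?ltW// -powRrM (_ : 1 / 6 * 6%:R = 1) ?powRr1 ?ltW//.
  by rewrite mul1r mulVf// pnatr_eq0.
(* The bound 8 h^6 of [joint_spectral_radius_close] is 4 * (2 D): the entrywise norm is at
   most 4 times the spectral norm, and 2 D exceeds the distance. *)
have [h1|h1] := leP h 1.
  apply: (joint_spectral_radius_close M0 N0 c1 Mc Nc h0 h1) => B NB.
  have [|A MA BA] := @hausdorff_dist_near R s 2 M N (2 * D) B _ NB.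
    by rewrite -/D ltr_pMl// ltr1n.
  exists A => //; apply: le_trans (entry_norm_le_spectral_norm _) _.
  rewrite h6 (_ : 8 * D = (2 * 2)%:R * (2 * D)); last by rewrite mulrA -natrM.
  by rewrite ler_wpM2l// ltW.
(* For distant sets the trivial bounds 0 <= rho <= c suffice. *)
have N_le_c : joint_spectral_radius N <= c.
  apply: (joint_spectral_radius_le N0 c0 Nc).
  by split=> //; eexists; exact: growth_bound_expn.
have M_ge0 := joint_spectral_radius_ge0 M0 c0 Mc.
apply: (le_trans N_le_c); rewrite -[c in leLHS]add0r -mulrA lerD//.
apply: (@le_trans _ _ (c * h)); first by rewrite ler_peMr ?ltW.
by rewrite ler_peMl ?mulr_ge0 ?ltW// ltr1n.
Qed.

Theorem corollary28 (R : realType) (s : scalar_kind)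
  (K : set (compacts R s 2)) (Kcompact : compact K)
  (Kpos : K `<=` positive_jsr) :
  (ereal_sup [set x : \bar R | exists M N : compacts R s 2,
     [/\ K M, K N, M <> N &
      x = (`|joint_spectral_radius M - joint_spectral_radius N| /
           hausdorff_dist M N `^ (1 / 6))%:E]] < +oo)%E.
Proof.
have [c0 Kc0] := compact_hausdorff_bounded Kcompact.
pose c := Num.max 1 (4 * c0).
have c1 : 1 <= c by rewrite le_max lexx.
have Kc M : K M -> forall A, compacts_set M A -> entry_norm A <= c.
  move=> KM A MA; apply: le_trans (entry_norm_le_spectral_norm _) _.
  rewrite le_max; apply/orP; right; rewrite ler_wpM2l//; exact: Kc0 KM _ MA.
apply: (@le_lt_trans _ _ (159 * c)%:E); last exact: ltry.
apply: ge_ereal_sup => _ [M [N [KM KN MN ->]]]; rewrite lee_fin.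
have D0 : 0 < hausdorff_dist M N by rewrite -mdist_compactsE mdist_gt0; apply/eqP.
rewrite ler_pdivrMr ?powR_gt0// ler_distlC.
have MNle := joint_spectral_radius_hoelder c1 (Kc M KM) (Kc N KN) MN.
have NMle := joint_spectral_radius_hoelder c1 (Kc N KN) (Kc M KM) (nesym MN).
by rewrite MNle andbT lerBlDr [hausdorff_dist M N]hausdorff_distC.
Qed.
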